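(* Let $W_{\boldsymbol\lambda}$ be a conditionally positive definite (CPD) unilateral weighted shift with weights $\boldsymbol\lambda=\{\lambda_k\}_{k=0}^\infty$, let $(b,c,\nu)$ be its scalar representing triplet and let $(B,C,F)$ be the representing triplet of the operator $W_{\boldsymbol\lambda}$. Suppose that $\sup\mathrm{supp}(\nu)>1$ and $1\notin\mathrm{supp}(\nu)$. Then $F(\mathbb{R}_+)$ is not compact.
   Context: $\mathbb{Z}_+=\{0,1,2,\dots\}$, $\mathbb{R}_+=[0,\infty)$; scalar measures are positive; $\mathrm{supp}$ denotes closed support. The polynomials $Q_n$ are $Q_0=Q_1=0$ and $Q_n(x)=\sum_{j=0}^{n-2}(n-j-1)x^j$ for $n\geq 2$. A real sequence $\{\gamma_n\}_{n=0}^\infty$ is CPD if $\sum_{i,j=0}^k \gamma_{i+j}\alpha_i\bar\alpha_j\geq 0$ for every finite sequence $\alpha_0,\dots,\alpha_k\in\mathbb{C}$ with $\sum_{j=0}^k\alpha_j=0$. A bounded operator $T$ on a complex Hilbert space $\mathcal{H}$ is CPD if $\{\|T^nh\|^2\}_{n=0}^\infty$ is CPD for every $h\in\mathcal{H}$. A semispectral measure on $\mathbb{R}_+$ is a map $F$ from the Borel $\sigma$-algebra of $\mathbb{R}_+$ to the bounded operators on $\mathcal{H}$ such that $\langle F(\cdot)h,h\rangle$ is a (positive) measure for every $h\in\mathcal{H}$. It is known that $T$ is CPD if and only if there are bounded operators $B=B^*$, $C\geq0$ and a compactly supported semispectral measure $F$ on $\mathbb{R}_+$ with $F(\{1\})=0$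 such that $T^{*n}T^n=I+nB+n^2C+\int_{\mathbb{R}_+}Q_n(x)\,F(dx)$ for all $n\in\mathbb{Z}_+$; the triplet $(B,C,F)$ is then unique and is called the representing triplet of $T$. For a bounded sequence $\boldsymbol\lambda$ of positive reals, $W_{\boldsymbol\lambda}$ is the bounded operator on $\ell^2$ with $W_{\boldsymbol\lambda}e_n=\lambda_ne_{n+1}$ ($\{e_n\}$ the standard orthonormal basis); $\hat\lambda_0=1$ and $\hat\lambda_n=\lambda_0^2\cdots\lambda_{n-1}^2$ for $n\geq1$. If $W_{\boldsymbol\lambda}$ is CPD, its scalar representing triplet is the unique $(b,c,\nu)$ with $b\in\mathbb{R}$, $c\in\mathbb{R}_+$, $\nu$ a compactly supported finite Borel measure on $\mathbb{R}_+$ with $\nu(\{1\})=0$ and $\hat\lambda_n=1+bn+cn^2+\int_{\mathbb{R}_+}Q_n\,d\nu$ for all $n\in\mathbb{Z}_+$. *)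

(* Defs.v *)
From HB Require Import structures.
From mathcomp Require Import all_boot all_order all_algebra.
From mathcomp Require Import complex.
From mathcomp Require Import all_classical all_reals all_analysis.
From mathcomp Require Import ring.

Set Implicit Arguments.
Unset Strict Implicit.
Unset Printing Implicit Defensive.

Import Order.TTheory GRing.Theory Num.Theory.
Import numFieldNormedType.Exports.

Local Open Scope classical_set_scope.
Local Open Scope ring_scope.

Section complex_topology.
Variable R : realType.

(* MathComp-Analysis equips numeric fields with their topology through the alias
   (R[i])^o; this makes it canonical on R[i] itself. *)
HB.instance Definition _ := NormedModule.copy R[i] (R[i])^o.

Lemma cvg_complex (u v : R^nat) (a b : R) :
  u @ \oo --> a -> v @ \oo --> b ->
  (fun n => Complex (u n) (v n)) @ \oo --> Complex a b.
Proof.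
move=> ua vb; apply/cvgrPdist_lt => e e0.
have er : e \is Num.real by rewrite realE ltW.
have Ree0 : 0 < complex.Re e / 2.
  by move: e0; rewrite ltcE => /andP[_ /= ?]; rewrite divr_gt0.
have : forall z : R[i], `|z| <= (`|complex.Re z| + `|complex.Im z|)%:C%C.
  move=> [x y]; rewrite normc_def /= lecR -[leRHS]ger0_norm ?addr_ge0//.
  rewrite -sqrtr_sqr ler_wsqrtr// sqrrD !real_normK ?num_real//.
  by rewrite lerD2r lerDl mulrn_wge0// mulr_ge0.
move=> le_norm.
move/cvgrPdist_lt : ua => /(_ _ Ree0) ua.
move/cvgrPdist_lt : vb => /(_ _ Ree0) vb.
near=> n; apply: (le_lt_trans (le_norm _)).
rewrite -[ltRHS](RRe_real er) ltcR [ltRHS]splitr ltrD//=.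
- by near: n.
- by near: n.
Unshelve. all: by end_near. Qed.

Lemma cvg_Re (u : nat -> R[i]) (a : R[i]) : u @ \oo --> a ->
  (fun n => complex.Re (u n)) @ \oo --> complex.Re a.
Proof.
move=> ua; apply/cvgrPdist_lt => e e0.
move/cvgrPdist_lt : (ua) => /(_ (e%:C%C)).
rewrite ltcR => /(_ e0); apply: filterS => n.
rewrite -(ltcR `|_|); apply: le_lt_trans.
apply: le_trans (normc_ge_Re _).
by case: a {ua} => ? ?; case: (u n).
Qed.

Lemma cvg_Im (u : nat -> R[i]) (a : R[i]) : u @ \oo --> a ->
  (fun n => complex.Im (u n)) @ \oo --> complex.Im a.
Proof.
move=> ua; have := @cvg_Re (fun n => - (u n * 'i%C)) (- (a * 'i%C)).
have ReN z : complex.Re (- (z * 'i%C)) = complex.Im z :> R.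
  by rewrite -[RHS]opprK -ReiNIm; case: (_ * _).
rewrite ReN (_ : (fun n => complex.Re _) = (fun n => complex.Im (u n))).
  by apply; apply: cvgN; exact: cvgMl.
by apply/funext => n; rewrite ReN.
Qed.

Lemma cvg_real_complex (u : R^nat) :
  cvgn (fun n => (u n)%:C%C : R[i]) <-> cvgn u.
Proof.
split=> [/cvg_ex[/= l /cvg_Re ul]|/cvg_ex[/= l ul]].
  by apply/cvg_ex; exists (complex.Re l).
by apply/cvg_ex; exists (l%:C%C); apply: cvg_complex => //; exact: cvg_cst.
Qed.

Lemma series_real_complex (u : R^nat) :
  series (fun k => (u k)%:C%C : R[i]) = (fun n => (series u n)%:C%C).
Proof. by apply/funext => n; rewrite /series /= rmorph_sum. Qed.

Lemma series_ReIm (u : nat -> R[i]) : series u =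
  (fun n => Complex (series (fun k => complex.Re (u k)) n)
                    (series (fun k => complex.Im (u k)) n)).
Proof.
apply/funext => n; rewrite /series /=.
elim: n => [|n ih]; first by rewrite !big_geq.
by rewrite !big_nat_recr//= ih; case: (u n).
Qed.

Lemma cvg_series_dominated (u : nat -> R[i]) (v : R^nat) :
  (forall k, `|u k| <= (v k)%:C%C) -> cvgn (series v) -> cvgn (series u).
Proof.
move=> uv cv.
have dom (w : R^nat) : (forall k, `|w k| <= v k) -> cvgn (series w).
  move=> wv; apply: normed_cvg; apply: series_le_cvg cv => k.
  - exact: normr_ge0.
  - exact: le_trans (normr_ge0 _) (wv k).
  - exact: wv.
have /cvg_ex[/= a ua] : cvgn (series (fun k => complex.Re (u k))).
  by apply: dom => k; rewrite -lecR; exact: le_trans (normc_ge_Re _) (uv k).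
have /cvg_ex[/= b ub] : cvgn (series (fun k => complex.Im (u k))).
  apply: dom => k; rewrite -lecR; apply: le_trans (uv k).
  rewrite -normrN -ReiNIm; apply: le_trans (normc_ge_Re _) _.
  by rewrite normrM [`|'i%C|]normc_def/= expr0n expr1n add0r sqrtr1 mulr1.
by rewrite series_ReIm; apply/cvg_ex; exists (Complex a b); exact: cvg_complex.
Qed.

End complex_topology.

Section ell2.
Variable R : realType.
Implicit Types f g h : nat -> R[i].

Definition square_summable : {pred nat -> R[i]} :=
  fun f => `[< cvgn (series (fun k => `|f k| ^+ 2)) >].

Lemma square_summableP f : reflect
  (cvgn (series (fun k => complex.Re (f k) ^+ 2 + complex.Im (f k) ^+ 2)))
  (f \in square_summable).
Proof.
apply: (iffP (asboolP _)); rewrite (_ : (fun k => `|f k| ^+ 2) =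
    (fun k => (complex.Re (f k) ^+ 2 + complex.Im (f k) ^+ 2)%:C%C)).
- by rewrite series_real_complex => /cvg_real_complex.
- by apply/funext => k; rewrite add_Re2_Im2.
- by rewrite series_real_complex => /cvg_real_complex.
- by apply/funext => k; rewrite add_Re2_Im2.
Qed.

Lemma square_summable_submod : GRing.submod_closed square_summable.
Proof.
split=> [|a f g /square_summableP cf /square_summableP cg].
  apply/square_summableP; rewrite [X in cvgn X](_ : _ = cst 0 :> R^nat).
    exact: is_cvg_cst.
  by apply/funext => n; rewrite /series/= big1// => k _; rewrite expr0n addr0.
apply/square_summableP.
set c := 2 * (complex.Re a ^+ 2 + complex.Im a ^+ 2).
have cv : cvgn (series (c *: (fun k => complex.Re (f k) ^+ 2 + complex.Im (f k) ^+ 2)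
    + 2 *: (fun k => complex.Re (g k) ^+ 2 + complex.Im (g k) ^+ 2) : R^nat)).
  by rewrite seriesD !seriesZ; apply: is_cvgD; exact: is_cvgZr.
apply: series_le_cvg cv => k /=.
- by rewrite addr_ge0 ?sqr_ge0.
- change (0 <= c * (complex.Re (f k) ^+ 2 + complex.Im (f k) ^+ 2) +
    2 * (complex.Re (g k) ^+ 2 + complex.Im (g k) ^+ 2)).
  by rewrite addr_ge0// mulr_ge0 ?mulr_ge0 ?addr_ge0 ?sqr_ge0.
- change (complex.Re (a * f k + g k) ^+ 2 + complex.Im (a * f k + g k) ^+ 2 <=
    c * (complex.Re (f k) ^+ 2 + complex.Im (f k) ^+ 2) +
    2 * (complex.Re (g k) ^+ 2 + complex.Im (g k) ^+ 2)).
  rewrite /c.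
  case: a (f k) (g k) {c cf cg} => [x y] [p q] [r s] /=.
  rewrite -subr_ge0.
  rewrite (_ : _ - _ = (x * p - y * q - r) ^+ 2 + (x * q + y * p - s) ^+ 2).
    by rewrite addr_ge0 ?sqr_ge0.
  by ring.
Qed.

HB.instance Definition _ := GRing.isSubmodClosed.Build R[i] (nat -> R[i])
  square_summable square_summable_submod.

Record ell2 : Type := Ell2 {
  ell2_val :> nat -> R[i];
  ell2P : ell2_val \in square_summable }.

HB.instance Definition _ := [isSub for ell2_val].
HB.instance Definition _ := [Choice of ell2 by <:].
HB.instance Definition _ := [SubChoice_isSubLmodule of ell2 by <:].

End ell2.

Section ell2_inner_product.
Variable R : realType.
Implicit Types f g h : ell2 R.

(* Linear in the first argument. *)
Definition l2dot f g : R[i] := limn (series (fun k => f k * (g k)^*)).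

Lemma is_cvg_dot f g : cvgn (series (fun k => f k * (g k)^*)).
Proof.
pose v (h : ell2 R) k := complex.Re (h k) ^+ 2 + complex.Im (h k) ^+ 2.
apply: (@cvg_series_dominated _ _ (v f + v g)) => [k|].
  have -> : ((v f + v g) k)%:C%C = `|f k| ^+ 2 + `|g k| ^+ 2.
    by rewrite -!add_Re2_Im2 -rmorphD.
  rewrite normrM norm_conjC.
  have [fg|/ltW gf] := real_leP (normr_real (f k)) (normr_real (g k)).
    by rewrite (le_trans (ler_wpM2r _ fg))// -expr2 lerDr exprn_ge0.
  by rewrite (le_trans (ler_wpM2l _ gf))// -expr2 lerDl exprn_ge0.
rewrite seriesD; apply: is_cvgD; apply/square_summableP; exact: ell2P.
Qed.

Lemma cvg_dot f g : series (fun k => f k * (g k)^*) @ \oo --> l2dot f g.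
Proof. exact: is_cvg_dot. Qed.

Lemma dot_conj f g : l2dot f g = (l2dot g f)^*.
Proof.
have cgf := @cvg_dot g f; set S := series _ in cgf.
have H := cvg_complex (cvg_Re cgf) (cvgN (cvg_Im cgf)).
have -> : (l2dot g f)^* = Complex (complex.Re (l2dot g f)) (- complex.Im (l2dot g f)).
  by case: (l2dot g f).
rewrite -(cvg_lim _ (H _))//; rewrite /l2dot; congr (limn _).
apply/funext => n.
transitivity ((S n)^*); last first.
  change ((S n)^* = Complex (complex.Re (S n)) (- complex.Im (S n))).
  by case: (S n).
rewrite /S /series/= rmorph_sum; apply: eq_bigr => k _.
by rewrite rmorphM/= conjCK mulrC.
Qed.

Lemma dotPl a f g h : l2dot (a *: f + g) h = a * l2dot f h + l2dot g h.
Proof.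
apply/cvg_lim => //.
rewrite (_ : series _ = a *: series (fun k => f k * (h k)^*) +
                        series (fun k => g k * (h k)^*)).
  by apply: cvgD (@cvg_dot g h); apply: cvgZr; exact: cvg_dot.
rewrite -seriesZ -seriesD; congr series; apply/funext => k.
change ((a * f k + g k) * (h k)^* = a * (f k * (h k)^*) + g k * (h k)^*).
by rewrite mulrDl mulrA.
Qed.

Lemma dot_is_bilinear : bilinear_for
  (GRing.Scale.Law.clone _ _ *%R _) (GRing.Scale.Law.clone _ _ (Num.conj \; *%R) _)
  l2dot.
Proof.
split=> [h|h] a f g /=; first exact: dotPl.
by rewrite dot_conj dotPl rmorphD rmorphM/= -!dot_conj.
Qed.

HB.instance Definition _ := bilinear_isBilinear.Build R[i] (ell2 R) (ell2 R) R[i]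
  (GRing.Scale.Law.clone _ _ ( *%R ) _) (GRing.Scale.Law.clone _ _ (Num.conj \; *%R) _)
  l2dot dot_is_bilinear.

Lemma dot_hermitian f g : l2dot f g = (-1) ^+ false * (l2dot g f)^*.
Proof. by rewrite mul1r -dot_conj. Qed.

HB.instance Definition _ := @isHermitianSesquilinear.Build _ _ _ _ l2dot dot_hermitian.

Lemma dot_gt0 f : f != 0 -> 0 < l2dot f f.
Proof.
move=> f0.
have [k fk0] : exists k, f k != 0.
  apply: contrapT => /forallNP fk; move/eqP: f0; apply; apply/val_inj/funext => k.
  by apply/eqP; apply: contrapT => /negP /(fk k).
pose w i : R := complex.Re (f i) ^+ 2 + complex.Im (f i) ^+ 2.
have w0 i : 0 <= w i by rewrite addr_ge0 ?sqr_ge0.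
have cw : cvgn (series w) by apply/square_summableP; exact: ell2P.
have dotE : l2dot f f = (limn (series w))%:C%C.
  apply/cvg_lim => //; rewrite (_ : series _ = (fun n => Complex (series w n) 0)).
    exact: cvg_complex cw (cvg_cst _).
  have := series_real_complex w; rewrite /real_complex_def => <-.
  by congr series; apply/funext => i; rewrite -normCK -add_Re2_Im2.
rewrite dotE ltcR; apply: (@lt_le_trans _ _ (w k)).
  rewrite lt_def w0 andbT; apply: contra fk0.
  by rewrite -(inj_eq (@complexI _)) /w add_Re2_Im2 expf_eq0 normr_eq0.
apply: (@le_trans _ _ (series w k.+1)).
  by rewrite /series/= big_nat_recr//= lerDr sumr_ge0.
apply: nondecreasing_cvgn_le => //; exact: nondecreasing_series.
Qed.

HB.instance Definition _ := @isDotProduct.Build _ _ l2dot dot_gt0.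

(* The norm of a module normed over R[i] is R[i]-valued. *)
Definition l2norm f : R[i] := sqrtC (l2dot f f).

Let l2norm_sqr f : l2norm f ^+ 2 = l2dot f f. Proof. exact: sqrtCK. Qed.

Let l2norm_ge0 f : 0 <= l2norm f.
Proof. by rewrite sqrtC_ge0; exact: (dnorm_ge0 l2dot). Qed.

Lemma l2_CauchySchwarz f g : `|l2dot f g| <= l2norm f * l2norm g.
Proof.
rewrite -(@ler_pXn2r _ 2)// ?nnegrE ?mulr_ge0// exprMn !l2norm_sqr.
have [->|g0] := eqVneq g 0.
  by rewrite !(linear0r l2dot)/= normr0 expr0n mulr0.
have gg := dot_gt0 g0.
pose q := `|l2dot f g| ^+ 2 / l2dot g g.
have q_ge0 : 0 <= q by rewrite divr_ge0 ?exprn_ge0// ltW.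
pose a := l2dot f g / l2dot g g.
have aE : l2dot f (a *: g) = q.
  rewrite (linearZr_LR l2dot)/= /a rmorphM fmorphV/= -[(l2dot g g)^*]dot_conj.
  by rewrite mulrAC [_^* * _]mulrC -normCK.
have agE : l2dot (a *: g) (a *: g) = q.
  rewrite (dnormZ l2dot) /a normrM normfV (gtr0_norm gg) exprMn.
  by rewrite /q exprVn expr2 invfM -!mulrA mulVf ?mulr1// gt_eqF.
have := dnorm_ge0 l2dot (f - a *: g).
rewrite (dnormB l2dot)/= aE agE (CrealP (ger0_real q_ge0)) addrKA subr_ge0.
by rewrite /q ler_pdivrMr.
Qed.

Lemma ler_l2normD f g : l2norm (f + g) <= l2norm f + l2norm g.
Proof.
rewrite -(@ler_pXn2r _ 2)// ?nnegrE ?addr_ge0// sqrrD !l2norm_sqr.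
rewrite (dnormD l2dot)/= [leRHS]addrAC lerD2l.
rewrite (_ : _ + _ = 'Re (l2dot f g) *+ 2).
  rewrite ler_pMn2r//; apply: le_trans (l2_CauchySchwarz f g).
  exact: (leif_Re_Creal _).1.
by rewrite ReE -mulr_natr divfK ?pnatr_eq0.
Qed.

Lemma l2normZ a f : l2norm (a *: f) = `|a| * l2norm f.
Proof.
by rewrite /l2norm (dnormZ l2dot) sqrtCM ?nnegrE ?exprn_ge0 ?(dnorm_ge0 l2dot)// sqrCK.
Qed.

Lemma l2norm_eq0 f : l2norm f = 0 -> f = 0.
Proof. by move/eqP; rewrite (sqrt_dnorm_eq0 l2dot) => /eqP. Qed.

HB.instance Definition _ := Lmodule_isNormed.Build R[i] (ell2 R)
  ler_l2normD l2normZ l2norm_eq0.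

End ell2_inner_product.

Section ell2_basis.
Variable R : realType.

Lemma square_summable_delta n :
  (fun k => (k == n)%:R : R[i]) \in @square_summable R.
Proof.
apply/asboolP; set u : nat -> R[i] := fun k => _.
apply: (@is_cvg_near_cst _ _ (series u n.+1)); near=> N.
have nN : (n < N)%N by near: N; exists n.+1.
rewrite /series/= (big_cat_nat (n := n.+1))//=.
rewrite [X in _ + X]big_nat_cond [X in _ + X]big1 ?addr0// => k.
by rewrite andbT => /andP[nk _]; rewrite /u gtn_eqF// normr0 expr0n.
Unshelve. all: by end_near. Qed.

Definition ell2_basis n : ell2 R := Ell2 (square_summable_delta n).

End ell2_basis.

Section operators.
Variable R : realType.
Implicit Types T S : {linear ell2 R -> ell2 R}.

Definition bounded_op T : Prop :=
  exists M : R, forall h, `|T h| <= M%:C%C * `|h|.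

Definition adjoint_op T S : Prop := forall f g, l2dot (T f) g = l2dot f (S g).

(* On R[i], [0 <= z] means that z is real and nonnegative. *)
Definition positive_op T : Prop := forall h, 0 <= l2dot (T h) h.

Definition compact_op T : Prop :=
  compact (closure (T @` [set h | `|h| <= 1])).

Definition cpd_seq (gamma : R^nat) : Prop :=
  forall (k : nat) (alpha : 'I_k.+1 -> R[i]), \sum_(i < k.+1) alpha i = 0 ->
  0 <= \sum_(i < k.+1) \sum_(j < k.+1)
         (gamma (i + j)%N)%:C%C * alpha i * (alpha j)^*.

Definition cpd_op T : Prop :=
  forall h, cpd_seq (fun n => complex.Re `|iter n T h| ^+ 2).

Definition is_weighted_shift (lam : R^nat) T : Prop :=
  bounded_op T /\
  forall n, T (ell2_basis R n) = (lam n)%:C%C *: ell2_basis R n.+1.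

End operators.

Section representing_triplets.
Variable R : realType.

(* Borel measures and semispectral measures on [0, +oo[ are rendered as measures
   on the Borel sets of R for which ]-oo, 0[ is null. *)

Definition Rplus : set R := `[0, +oo[%classic.

Definition supp (mu : set R -> \bar R) : set R :=
  [set x | forall U, open U -> U x -> (0 < mu U)%E].

(* The sum is empty, hence zero, for n = 0 and n = 1. *)
Definition Qpoly n : {poly R} := \poly_(j < n.-1) (n - j - 1)%:R.

Definition lam_hat (lam : R^nat) n : R := \prod_(k < n) lam k ^+ 2.

Record scalar_triplet (lam : R^nat) (b c : R)
    (nu : {finite_measure set R -> \bar R}) : Prop := {
  scalar_c_ge0 : 0 <= c ;
  scalar_nu_Rplus : nu (~` Rplus) = 0%E ;
  scalar_nu_supp : compact (supp nu) ;
  scalar_nu1 : nu [set 1] = 0%E ;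
  scalar_tripletE : forall n, lam_hat lam n = 1 + b * n%:R + c * n%:R ^+ 2 +
    \int[nu]_(x in Rplus) (Qpoly n).[x] }.

Implicit Types (T G B C : {linear ell2 R -> ell2 R}).
Implicit Types (F : set R -> {linear ell2 R -> ell2 R}).

(* [mu] is the scalar measure <F(.)h, h>. *)
Definition marginal F (h : ell2 R) (mu : {finite_measure set R -> \bar R}) :=
  forall A, measurable A -> l2dot (F A h) h = (fine (mu A))%:C%C.

Record semispectral F : Prop := {
  semispectral_bounded : forall A, measurable A -> bounded_op (F A) ;
  semispectral_measure : forall h, exists mu, marginal F h mu ;
  semispectral_Rplus : forall h, F (~` Rplus) h = 0 }.

Definition supp_op F : set R :=
  [set x | forall U, open U -> U x -> exists h, F U h != 0].

(* G is the operator \int f dF, i.e. <G h, h> = \int f d<F(.)h, h> for all h. *)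
Definition is_op_integral F (f : R -> R) G : Prop :=
  bounded_op G /\
  forall h mu, marginal F h mu ->
    mu.-integrable Rplus (EFin \o f) /\
    l2dot (G h) h = (\int[mu]_(x in Rplus) f x)%:C%C.

Record representing_triplet T B C F : Prop := {
  triplet_B_bounded : bounded_op B ;
  triplet_B_selfadjoint : adjoint_op B B ;
  triplet_C_bounded : bounded_op C ;
  triplet_C_positive : positive_op C ;
  triplet_F_semispectral : semispectral F ;
  triplet_F_supp : compact (supp_op F) ;
  triplet_F1 : forall h, F [set 1] h = 0 ;
  tripletE : exists Tadj : {linear ell2 R -> ell2 R},
    [/\ bounded_op Tadj, adjoint_op T Tadj &
      forall n, exists2 G, is_op_integral F (fun x => (Qpoly n).[x]) G &
        forall h, iter n Tadj (iter n T h) =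
          h + n%:R *: B h + n%:R ^+ 2 *: C h + G h] }.

End representing_triplets.

(* Main.v *)
Require Import Defs.
From mathcomp Require Import all_boot all_order all_algebra.
From mathcomp Require Import complex.
From mathcomp Require Import all_classical all_reals all_analysis.
From mathcomp Require Import measurable_realfun.
From mathcomp Require Import ring lra zify.

(** Write [delta k] for the basis vectors, [mu_k] for the scalar measure
    <F(.) delta_k, delta_k> and L_n for [lam_hat lam n]. The claim follows once
    the diagonal entries <F(R_+) delta_k, delta_k> = mu_k(R_+) stay above some
    positive number, because a compact operator maps the weakly null sequence
    (delta_k) to a sequence tending to 0 along a subsequence
    ([compact_op_diag]).

    To bound mu_k(R_+) from below, compare the two triplets. Since
    |W^n delta_k|^2 = L_(n+k) / L_k ([dot_iter_shift]), the sequence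
    n |-> L_(n+k) / L_k is a quadratic polynomial in n plus the integral of Q_n
    against mu_k ([lam_hat_triplet]), while L_n itself is a quadratic polynomial
    in n plus the integral of Q_n against nu. The fourth difference of
    (Q_n) is (x - 1)^2 x^n ([diff4_Qpoly]), and it kills the quadratic parts, so
    the unknown diagonal entries of B and C disappear:

      L_k * int (x - 1)^2 dmu_k = diff4 L k = int (x - 1)^2 x^k dnu.

    The left-hand side is at most a constant times L_k * mu_k(R_+), the constant
    being the same for all k since every mu_k lives on the compact support of F.
    It remains to see that the right-hand side is at least a constant times L_k
    ([lam_hat_le_diff4]). As 1 is not in supp nu, the factor (x - 1)^2 is bounded
    below by some d^2 nu-almost everywhere, and (x - 1)^2 Q_k = x^k - 1 - k(x - 1)
    gives d^2 Q_k <= x^k + k there; hence L_k is bounded by a multiple of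
    k^2 + 1 + int x^k dnu. As nu charges some half-line ]q, +oo[ with q > 1,
    the moment int x^k dnu grows at least like q^k and absorbs the quadratic
    term. *)

Import Order.TTheory GRing.Theory Num.Theory.
Import numFieldNormedType.Exports.

Local Open Scope classical_set_scope.
Local Open Scope ring_scope.

Set Implicit Arguments.
Unset Strict Implicit.

(** * Supports of finite measures on the line *)

Section supports.
Variable R : realType.
Implicit Types (mu : {finite_measure set R -> \bar R}) (A : set R).

(** The line is second countable, so the complement of the support is the union
    of countably many null intervals with rational endpoints. *)
Lemma negligible_setC_supp mu : mu.-negligible (~` supp mu).
Proof.
pose null_itv (pq : rat * rat) : set R :=
  if mu `](ratr pq.1 : R), ratr pq.2[%classic == 0%E
  then `]ratr pq.1, ratr pq.2[%classic else set0.
pose cover n := if unpickle n is Some pq then null_itv pq else set0.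
apply: (@negligibleS _ _ _ mu (\bigcup_n cover n)); last first.
  apply: negligible_bigcup => n; rewrite /cover.
  case: unpickle => [pq|]; last exact: negligible_set0.
  rewrite /null_itv; case: eqP => [mu0|_]; last exact: negligible_set0.
  by apply/negligibleP.
move=> x /existsNP[U /not_implyP[oU /not_implyP[Ux /negP]]].
rewrite lt_def measure_ge0 andbT negbK => /eqP muU.
have := open_nbhs_nbhs (conj oU Ux); rewrite -nbhs_ballE => -[e /= e0 eU].
have /rat_in_itvoo[p] : x - e < x by rewrite ltrBlDr ltrDl.
rewrite in_itv/= => /andP[ep px].
have /rat_in_itvoo[q] : x < x + e by rewrite ltrDl.
rewrite in_itv/= => /andP[xq qe].
have coverE r : cover (pickle r) = null_itv r by rewrite /cover pickleK.
exists (pickle (p, q)); [exact: I|rewrite coverE /null_itv/=].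
have pqU : `](ratr p : R), ratr q[%classic `<=` U.
  move=> y /=; rewrite in_itv/= => /andP[py yq]; apply: eU.
  by rewrite ball_itv/= in_itv/= (lt_trans ep py) (lt_trans yq qe).
rewrite (@subset_measure0 _ _ _ mu _ U)//; last exact: open_measurable.
by rewrite eqxx /= in_itv/= px xq.
Qed.

Lemma compact_sub_itv A : compact A ->
  exists2 K : R, 0 < K & A `<=` `[- K, K].
Proof.
move=> /compact_bounded[M [_ bM]]; exists (`|M| + 1) => [|x /bM].
  by rewrite ltr_wpDl.
by rewrite /= in_itv/= -ler_norml; apply; rewrite ltr_pwDr// ler_norm.
Qed.

Lemma measure_setC_supp_sub mu A : measurable A -> supp mu `<=` A ->
  mu (~` A) = 0%E.
Proof.
move=> mA muA; apply: measure_negligible; first exact: measurableC.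
by apply: negligibleS (negligible_setC_supp mu); exact: subsetC.
Qed.

Lemma null_ball_nsupp mu a : ~ supp mu a ->
  exists2 d : R, 0 < d & mu (ball a d) = 0%E.
Proof.
move=> /existsNP[U /not_implyP[oU /not_implyP[Ua /negP]]].
rewrite lt_def measure_ge0 andbT negbK => /eqP muU.
have := open_nbhs_nbhs (conj oU Ua); rewrite -nbhs_ballE => -[d /= d0 dU].
exists d => //; apply: (subset_measure0 _ _ dU) => //.
- exact: measurable_ball.
- exact: open_measurable.
Qed.

Lemma measurable_Rplus : measurable (@Rplus R).
Proof. exact: measurable_itv. Qed.

End supports.

(** * Integrals of polynomials against a boundedly supported measure *)

Section polynomial_moments.
Variable R : realType.

Lemma measurable_horner (p : {poly R}) (A : set R) :
  measurable_fun A (horner p).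
Proof.
apply: measurable_funTS; apply: continuous_measurable_fun.
exact: continuous_horner.
Qed.

Variables (mu : {finite_measure set R -> \bar R}) (K : R).
Hypothesis muK : mu (~` `[- K, K]) = 0%E.
Local Notation integral p := (\int[mu]_(x in @Rplus R) p.[x]).

Lemma integrable_horner (p : {poly R}) : mu.-integrable (@Rplus R) (EFin \o horner p).
Proof.
have mN : measurable (~` `[- K, K] : set R) by apply: measurableC.
apply: (integrableS (E := setT)) => //; first exact: measurable_Rplus.
have mpT : measurable_fun setT (EFin \o horner p).
  by apply/measurable_EFinP; exact: measurable_horner.
apply/(negligible_integrable mN _ _ muK) => //; rewrite setTD setCK.
apply: measurable_bounded_integrable => //.
- by rewrite ltey_eq fin_num_measure.
- exact: measurable_horner.
have /(@compact_bounded R R^o)[M [Mreal bM]] : compact (horner p @` `[- K, K]).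
  apply: continuous_compact; last exact: segment_compact.
  by apply: continuous_subspaceT; exact: continuous_horner.
by exists M; split => // y /bM le_y x xK; apply: le_y; exists x.
Qed.
Hint Resolve integrable_horner : core.

Lemma integral_hornerD p q : integral (p + q) = integral p + integral q.
Proof.
rewrite -RintegralD//; last exact: measurable_Rplus.
by apply: eq_Rintegral => x _; rewrite hornerD.
Qed.

Lemma integral_hornerZ a p : integral (a *: p) = a * integral p.
Proof.
rewrite -RintegralZl//; last exact: measurable_Rplus.
by apply: eq_Rintegral => x _; rewrite hornerZ.
Qed.

(** Pointwise comparison is only asked for off a null set; this is how the gap of
    the measure around 1 and its bounded support enter the estimates. *)
Lemma le_integral_horner N p q : measurable N -> mu N = 0%E ->
  (forall x, 0 <= x -> ~ N x -> p.[x] <= q.[x]) -> integral p <= integral q.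
Proof.
move=> mN muN pq; have mD := @measurable_Rplus R.
rewrite /Rintegral (negligible_integral mN mD)//; last exact: integrable_horner.
rewrite [in leRHS](negligible_integral mN mD)//; last exact: integrable_horner.
apply: le_Rintegral => //.
- exact: measurableD.
- by apply: integrableS (integrable_horner p) => //; exact: measurableD.
- by apply: integrableS (integrable_horner q) => //; exact: measurableD.
by move=> x []; rewrite /Rplus/= in_itv/= andbT; exact: pq.
Qed.

End polynomial_moments.

(** * Fourth differences of the polynomials Q_n *)

Section polynomials_Q.
Variable R : realType.

Lemma QpolyS n : Qpoly R n.+1 = Qpoly R n + \sum_(j < n) 'X^j.
Proof.
have -> : \sum_(j < n) 'X^j = \poly_(j < n) (1 : R).
  by rewrite poly_def; apply: eq_bigr => j _; rewrite scale1r.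
have coefQ m i : (Qpoly R m)`_i = (m - i - 1)%:R.
  rewrite coef_poly; case: ifPn => //; rewrite -leqNgt => mi.
  by rewrite (_ : (m - i - 1)%N = 0%N)//; lia.
apply/polyP => i; rewrite coefD !coefQ coef_poly.
by case: ifPn => ni; [rewrite natr1|rewrite addr0]; congr (_%:R); lia.
Qed.

(** Q_n is the remainder of order two in the Taylor expansion of X^n at 1,
    divided by (X - 1)^2. *)
Lemma mulr_Qpoly n :
  ('X - 1) ^+ 2 * Qpoly R n = 'X^n - 1 - n%:R *: ('X - 1).
Proof.
elim: n => [|n ih].
  by rewrite /Qpoly poly_def big_ord0 mulr0 expr0 subrr scale0r subr0.
rewrite QpolyS mulrDr ih [_ ^+ 2]expr2 -mulrA -subrX1 exprS.
by rewrite -[n.+1]addn1 natrD scalerDl scale1r; ring.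
Qed.

Definition diff4 {V : zmodType} (u : nat -> V) n :=
  u n.+4 - u n.+3 *+ 4 + u n.+2 *+ 6 - u n.+1 *+ 4 + u n.

(** After multiplication by (X - 1)^2 the Q_n become X^n minus a sequence affine in
    n, and the fourth difference of (X^n) is (X - 1)^4 X^n. *)
Lemma diff4_Qpoly n : diff4 (Qpoly R) n = ('X - 1) ^+ 2 * 'X^n.
Proof.
have X1_neq0 : ('X - 1 : {poly R}) ^+ 2 != 0.
  by rewrite expf_eq0 /= -polyC1 polyXsubC_eq0.
apply: (mulfI X1_neq0); rewrite /diff4 !(mulrDr, mulrN, mulrnAr) !mulr_Qpoly.
rewrite !exprS -![n.+4]addn4 -![n.+3]addn3 -![n.+2]addn2 -![n.+1]addn1.
rewrite !natrD !scalerDl !scaler_nat; ring.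
Qed.

Lemma diff4_quadratic (a b c : R) n :
  diff4 (fun n => a + b * n%:R + c * n%:R ^+ 2) n = 0.
Proof.
by rewrite /diff4 -![n.+4]addn4 -![n.+3]addn3 -![n.+2]addn2 -![n.+1]addn1 !natrD; ring.
Qed.

Section moments.
Variables (mu : {finite_measure set R -> \bar R}) (K : R).
Hypothesis muK : mu (~` `[- K, K]) = 0%E.
Local Notation integral p := (\int[mu]_(x in @Rplus R) p.[x]).

(** Fourth differences read off moments of the measure of a triplet without any
    knowledge of its quadratic part; second differences would still contain the
    coefficient [c]. *)
Lemma diff4_triplet (u : R^nat) (a b c : R) n :
  (forall n, u n = a + b * n%:R + c * n%:R ^+ 2 + integral (Qpoly R n)) ->
  diff4 u n = integral (('X - 1) ^+ 2 * 'X^n).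
Proof.
move=> uE; rewrite -diff4_Qpoly.
have IN p : integral (- p) = - integral p.
  by rewrite -scaleN1r (integral_hornerZ muK) mulN1r.
have IMn p m : integral (p *+ m) = integral p *+ m.
  by rewrite -scaler_nat (integral_hornerZ muK) mulr_natl.
rewrite [in RHS]/diff4 !(integral_hornerD muK) !IN !IMn.
have /eqP := diff4_quadratic a b c n; rewrite /diff4 !uE => /eqP E.
by rewrite -[RHS]add0r -{1}E; ring.
Qed.

(** The factor 'X^0 matches the shape of [diff4_triplet] at n = 0. *)
Lemma integral_sqr_le L : mu (~` `[- L, L]) = 0%E ->
  integral (('X - 1) ^+ 2 * 'X^0) <= (L + 1) ^+ 2 * fine (mu (@Rplus R)).
Proof.
move=> muL; rewrite -Rintegral_cst; last exact: measurable_Rplus.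
rewrite [X in _ <= Rintegral _ _ X](_ : _ = horner ((L + 1) ^+ 2)%:P); last first.
  by apply/funext => x; rewrite hornerC.
apply: (le_integral_horner muK (measurableC (measurable_itv _)) muL) => x x0.
rewrite /setC /= => /contrapT; rewrite in_itv/= => /andP[Lx xL].
rewrite !hornerE -subr_ge0 subr_sqr mulr_ge0//; lra.
Qed.

End moments.
End polynomials_Q.

(** * Growth of the products of squared weights *)

Section scalar_growth.
Variable R : realType.

Lemma natr_le_sqr (k : nat) : k%:R <= k%:R ^+ 2 :> R.
Proof. by rewrite -natrX ler_nat; case: k => // k; rewrite -mulnn leq_pmulr. Qed.

(** With t = q - 1, the binomial expansion of (1 + t)^k up to order two
    dominates k and k^2. *)
Lemma quadratic_le_expr (q : R) : 1 < q ->
  exists2 A, 0 < A & forall k, 1 + k%:R ^+ 2 <= A * q ^+ k.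
Proof.
move=> q1; pose t := q - 1; have t0 : 0 < t by rewrite subr_gt0.
have binomial_le k : 1 + t * k%:R + t ^+ 2 * (k%:R ^+ 2 - k%:R) / 2 <= q ^+ k.
  elim: k => [|k ih]; first by rewrite expr0; lra.
  have kk : 0 <= k%:R ^+ 2 - k%:R :> R.
    by rewrite subr_ge0 natr_le_sqr.
  have t3 : 0 <= t ^+ 3 * (k%:R ^+ 2 - k%:R) / 2.
    by rewrite divr_ge0// mulr_ge0// exprn_ge0// ltW.
  have qE : q = 1 + t by rewrite /t; lra.
  rewrite [q ^+ _]exprS {1}qE.
  apply: le_trans (ler_wpM2l (addr_ge0 ler01 (ltW t0)) ih).
  rewrite -natr1; nra.
(* k^2 + 1 = 1 + k + k (k - 1), and the three terms of the binomial lower bound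
   dominate 1, k and k (k - 1) after multiplication by 1, 1 / t and 2 / t^2. *)
exists (1 + 1 / t + 2 / t ^+ 2) => [|k].
  by rewrite !addr_gt0 ?divr_gt0 ?exprn_gt0.
apply: (@le_trans _ _ ((1 + 1 / t + 2 / t ^+ 2) *
   (1 + t * k%:R + t ^+ 2 * (k%:R ^+ 2 - k%:R) / 2))); last first.
  by rewrite ler_wpM2l// !addr_ge0 ?divr_ge0 ?exprn_ge0// ltW.
have kk : 0 <= k%:R ^+ 2 - k%:R :> R.
  by rewrite subr_ge0 natr_le_sqr.
have k0 : 0 <= k%:R :> R by rewrite ler0n.
set v := k%:R in kk k0 *; set w := v ^+ 2 - v in kk *.
have -> : (1 + 1 / t + 2 / t ^+ 2) * (1 + t * v + t ^+ 2 * w / 2) =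
  1 + v + w + (1 / t + 2 / t ^+ 2 + t * v + t ^+ 2 * w / 2 + 2 / t * v + t * w / 2).
  by field; rewrite gt_eqF.
have -> : 1 + v ^+ 2 = 1 + v + w by rewrite /w; ring.
rewrite lerDl.
by rewrite !addr_ge0 ?mulr_ge0 ?divr_ge0 ?exprn_ge0 ?invr_ge0// ?ltW// ?exprn_gt0.
Qed.

Lemma Qpoly_ge0 n (x : R) : 0 <= x -> 0 <= (Qpoly R n).[x].
Proof.
by move=> x0; rewrite horner_poly sumr_ge0// => j _; rewrite mulr_ge0 ?exprn_ge0.
Qed.

Lemma horner_Qpoly_le n (x d : R) : 0 <= x -> 0 <= d -> d <= `|x - 1| ->
  d ^+ 2 * (Qpoly R n).[x] <= x ^+ n + n%:R.
Proof.
move=> x0 d0 dx; have := mulr_Qpoly R n => /(congr1 (horner^~ x)).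
rewrite !(hornerM, hornerD, hornerN, hornerZ, horner_exp, hornerXn, hornerX, hornerC).
move=> /= E; apply: (@le_trans _ _ ((x - 1) ^+ 2 * (Qpoly R n).[x])).
  apply: ler_wpM2r; first exact: Qpoly_ge0.
  by rewrite -[leRHS]real_normK ?num_real// ler_sqr ?nnegrE.
rewrite E mulrBr mulr1.
have : 0 <= n%:R * x by rewrite mulr_ge0.
lra.
Qed.

Variables (lam : R^nat) (b c : R) (nu : {finite_measure set R -> \bar R}).
Hypothesis nuP : scalar_triplet lam b c nu.
Local Notation integral p := (\int[nu]_(x in @Rplus R) p.[x]).

Lemma integral_Xn_ge (q K : R) k : nu (~` `[- K, K]) = 0%E -> 0 <= q ->
  q ^+ k * fine (nu `]q, +oo[%classic) <= integral 'X^k.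
Proof.
move=> nuK q0; rewrite -Rintegral_cst//.
have sub : `]q, +oo[%classic `<=` @Rplus R.
  by move=> x; rewrite /Rplus/= !in_itv/= !andbT => /ltW; exact: (le_trans q0).
have intX := integrable_horner nuK 'X^k.
have mD := @measurable_Rplus R.
apply: (@le_trans _ _ (\int[nu]_(x in `]q, +oo[) ('X^k : {poly R}).[x])).
  apply: le_Rintegral => //.
  - apply: measurable_bounded_integrable => //.
      by rewrite ltey_eq fin_num_measure.
    exists (q ^+ k); split => [|y /ltW qy x _ /=]; first exact: num_real.
    by rewrite ger0_norm ?exprn_ge0.
  - exact: integrableS intX.
  - move=> x; rewrite /= in_itv/= andbT hornerXn => /ltW qx.
    by rewrite lerXn2r ?nnegrE// (le_trans q0).
apply: fine_le.
- by apply: integrable_fin_num => //; exact: integrableS intX.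
- exact: integrable_fin_num.
apply: ge0_subset_integral => //.
- by apply/measurable_EFinP; exact: measurable_horner.
by move=> x; rewrite /Rplus/= in_itv/= andbT lee_fin hornerXn => ?; rewrite exprn_ge0.
Qed.

(** Both sides are compared with the moments M_k of nu: the fourth difference is at
    least d^2 M_k because nu vanishes near 1, and [lam_hat lam k] is at most
    a constant times M_k because M_k grows exponentially. *)
Lemma lam_hat_le_diff4 : 1 < sup (supp nu) -> ~ supp nu 1 ->
  exists2 e, 0 < e & forall k, e * lam_hat lam k <= diff4 (lam_hat lam) k.
Proof.
move=> sup1 nu1.
have [K K0 suppK] := compact_sub_itv (scalar_nu_supp nuP).
have nuK : nu (~` `[- K, K]) = 0%E by exact: measure_setC_supp_sub.
have [d d0 nud] := null_ball_nsupp nu1.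
have le_off p p' : (forall x, 0 <= x -> d <= `|x - 1| -> p.[x] <= p'.[x]) ->
    integral p <= integral p'.
  move=> pp'; apply: (le_integral_horner nuK (measurable_ball _ _) nud) => x x0.
  by rewrite /ball/= distrC => /negP; rewrite -leNgt; exact: pp'.
(* Any q strictly between 1 and a point of the support will do. *)
have [x0 x0supp x01] : exists2 x, supp nu x & 1 < x.
  apply: sup_gt => //; apply/set0P/negP => /eqP supp0.
  by move: sup1; rewrite supp0 sup0 ltNge ler01.
pose q := (1 + x0) / 2; have q1 : 1 < q by rewrite /q; lra.
have q0 : 0 <= q by lra.
pose a := fine (nu `]q, +oo[%classic); have a0 : 0 < a.
  rewrite fine_gt0// ltey_eq fin_num_measure//= andbT.
  by apply: x0supp; [exact: interval_open|rewrite /= in_itv/= andbT /q; lra].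
have [A A0 quadA] := quadratic_le_expr q1.
pose M k := integral 'X^k; pose m := fine (nu (@Rplus R)).
have m0 : 0 <= m by rewrite fine_ge0.
have M_ge k : q ^+ k * a <= M k by exact: integral_Xn_ge nuK q0.
have diff4_ge k : d ^+ 2 * M k <= diff4 (lam_hat lam) k.
  rewrite (diff4_triplet nuK _ (scalar_tripletE nuP)) -(integral_hornerZ nuK).
  apply: le_off => x x_ge0 dx.
  rewrite !(hornerM, hornerZ, horner_exp, hornerXn, hornerD, hornerN, hornerX, hornerC).
  rewrite ler_wpM2r ?exprn_ge0//.
  by rewrite -[leRHS]real_normK ?num_real// ler_sqr ?nnegrE// ltW.
have Q_le k : d ^+ 2 * integral (Qpoly R k) <= M k + k%:R * m.
  rewrite -(integral_hornerZ nuK) /m -Rintegral_cst; last exact: measurable_Rplus.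
  have -> : \int[nu]_(x in @Rplus R) k%:R = integral (k%:R)%:P.
    by apply: eq_Rintegral => x _; rewrite hornerC.
  rewrite -(integral_hornerD nuK); apply: le_off => x x_ge0 dx.
  by rewrite hornerZ hornerD hornerXn hornerC horner_Qpoly_le// ltW.
pose S := 1 + `|b| + c + m / d ^+ 2.
have c0 := scalar_c_ge0 nuP.
have md0 : 0 <= m / d ^+ 2 by rewrite divr_ge0 ?exprn_ge0// ltW.
have S0 : 0 < S by rewrite /S !ltr_wpDr.
(* [S] bounds the coefficients of the quadratic part together with the term
   k m / d^2 from [Q_le]; [A / a] converts quadratic growth into moments. *)
pose D := S * A / a + (d ^+ 2)^-1.
have D0 : 0 < D by rewrite addr_gt0 ?divr_gt0 ?mulr_gt0 ?invr_gt0 ?exprn_gt0.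
have lam_le k : lam_hat lam k <= D * M k.
  rewrite (scalar_tripletE nuP) mulrDl.
  have := Q_le k; rewrite mulrC -ler_pdivlMr ?exprn_gt0// mulrDl => {}Q_le.
  have SA : S * (1 + k%:R ^+ 2) <= S * A / a * M k.
    rewrite -mulrA -mulrA ler_wpM2l ?(ltW S0)//.
    apply: le_trans (quadA k) _; rewrite ler_wpM2l ?(ltW A0)//.
    by rewrite mulrC ler_pdivlMr.
  have kk : k%:R <= k%:R ^+ 2 :> R by exact: natr_le_sqr.
  have k0 : 0 <= k%:R :> R by [].
  have bk : b * k%:R <= `|b| * k%:R by rewrite ler_wpM2r// ler_norm.
  have b0 := normr_ge0 b.
  have : 1 + `|b| * k%:R + c * k%:R ^+ 2 + k%:R * m / d ^+ 2 <= S * (1 + k%:R ^+ 2).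
    rewrite /S -[k%:R * m / _]mulrA; set u := m / _ in md0 *.
    move: b0 c0 md0 kk k0; set v := k%:R; set B := `|b|; move=> b0 c0 md0 kk k0.
    have h1 : 0 <= B * (v ^+ 2 - v) by rewrite mulr_ge0// subr_ge0.
    have h2 : 0 <= u * (v ^+ 2 - v) by rewrite mulr_ge0// subr_ge0.
    have h3 : 0 <= v ^+ 2 by rewrite exprn_ge0.
    lra.
  rewrite -[X in _ <= _ + X]mulrC; lra.
exists (d ^+ 2 / D) => [|k]; first by rewrite divr_gt0 ?exprn_gt0.
apply: le_trans (diff4_ge k); rewrite -mulrA ler_wpM2l ?exprn_ge0 ?(ltW d0)//.
by rewrite mulrC ler_pdivrMr// mulrC.
Qed.

End scalar_growth.

(** * Diagonal entries of compact operators *)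

Section diagonal_of_compact.
Variable R : realType.
Implicit Types (f g : ell2 R) (T : {linear ell2 R -> ell2 R}).
Local Notation delta := (ell2_basis R).

Lemma l2dot_basis f k : l2dot f (delta k) = f k.
Proof.
apply/cvg_lim => //; apply: cvg_near_cst; near=> N.
have kN : (k < N)%N by near: N; exists k.+1.
rewrite /series/= (bigD1_seq k) ?mem_index_iota ?iota_uniq//=.
rewrite eqxx rmorph1 mulr1 big1 ?addr0// => i ik.
by rewrite (negbTE ik) rmorph0 mulr0.
Unshelve. all: by end_near. Qed.

Lemma norm_basis k : `|delta k| = 1 :> R[i].
Proof. by rewrite /Num.norm/= /l2norm l2dot_basis /= eqxx sqrtC1. Qed.

Lemma ell2_cvg0 f : f k @[k --> \oo] --> (0 : R[i]).
Proof.
apply/cvgrPdist_lt => e e0.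
have /asboolP/cvg_series_cvg_0/cvgrPdist_lt/(_ (e ^+ 2)) := ell2P f.
rewrite exprn_gt0// => /(_ isT); apply: filterS => k.
rewrite !sub0r !normrN ger0_norm ?exprn_ge0// ltr_pXn2r// nnegrE.
exact: ltW.
Qed.

(** The sequence T delta_k has a cluster point g, so infinitely many T delta_k are
    close to g, while the coordinates of g tend to 0. *)
Lemma compact_op_diag T (e : R[i]) : compact_op T -> 0 < e ->
  exists k, `|l2dot (T (delta k)) (delta k)| < e.
Proof.
move=> cT e0; have e20 : 0 < e / 2 by rewrite divr_gt0.
have [|g [_ clg]] := cT ((fun k => T (delta k)) @ \oo) _.
  by exists 0%N => // k _; apply: subset_closure; exists (delta k); rewrite //= norm_basis.
have /cvgrPdist_lt/(_ _ e20)[N _ gN] := ell2_cvg0 g.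
have tail : ((fun k => T (delta k)) @ \oo) [set T (delta k) | k in [set k | (N <= k)%N]].
  by exists N => // k /= Nk; exists k.
have [_ [[k /= Nk <-] gk]] := clg _ _ tail (nbhsx_ballx g _ e20).
exists k; rewrite -[T _](subrK g) (linearDl (@l2dot R))/= [X in _ + X]l2dot_basis.
apply: le_lt_trans (ler_normD _ _) _; rewrite [ltRHS](splitr e) ltrD//.
  apply: le_lt_trans (l2_CauchySchwarz _ _) _.
  have normE h : l2norm h = `|h| by [].
  by rewrite !normE norm_basis mulr1 distrC.
by have := gN k Nk; rewrite sub0r normrN.
Qed.

End diagonal_of_compact.

(** * Diagonal entries of the triplet of a weighted shift *)

Section weighted_shift.
Variables (R : realType) (lam : R^nat).
Local Notation delta := (ell2_basis R).

Lemma lam_hatS n : lam_hat lam n.+1 = lam_hat lam n * lam n ^+ 2.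
Proof. by rewrite /lam_hat big_ord_recr. Qed.

Lemma lam_hat_gt0 n : (forall n, 0 < lam n) -> 0 < lam_hat lam n.
Proof. by move=> lam0; apply: prodr_gt0 => i _; rewrite exprn_gt0. Qed.

Lemma iter_adjoint (T S : {linear ell2 R -> ell2 R}) n f g :
  adjoint_op T S -> l2dot (iter n S f) g = l2dot f (iter n T g).
Proof.
move=> TS; elim: n g => //= n ih g.
by rewrite dot_conj -TS -dot_conj ih -iterSr.
Qed.

(** W^n maps delta_k to lam_k ... lam_(n+k-1) delta_(n+k). *)
Lemma dot_iter_shift (W : {linear ell2 R -> ell2 R}) n k :
  is_weighted_shift lam W ->
  (lam_hat lam k)%:C%C * l2dot (iter n W (delta k)) (iter n W (delta k)) =
  (lam_hat lam (n + k))%:C%C.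
Proof.
move=> [_ We].
have iterE : iter n W (delta k) = (\prod_(j < n) lam (j + k)%N)%:C%C *: delta (n + k)%N.
  elim: n => [|n ih]; first by rewrite big_ord0 scale1r.
  by rewrite iterS ih linearZ /= We scalerA -rmorphM big_ord_recr.
rewrite iterE (linearZl_LR (@l2dot R)) (linearZr_LR (@l2dot R))/= l2dot_basis /=.
rewrite eqxx mulr1 conj_Creal ?complex_real// -!rmorphM; congr (_%:C%C).
rewrite -expr2; elim: n {iterE} => [|n ih]; first by rewrite big_ord0 expr1n mulr1.
by rewrite addSn lam_hatS -ih big_ord_recr/= exprMn mulrA.
Qed.

End weighted_shift.

Section diagonal_marginals.
Variable R : realType.
Local Notation delta := (ell2_basis R).

(** This makes the bound on the supports uniform over all marginals of F. *)
Lemma supp_marginal (F : set R -> {linear ell2 R -> ell2 R}) h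
    (mu : {finite_measure set R -> \bar R}) :
  marginal F h mu -> supp mu `<=` supp_op F.
Proof.
move=> Fmu x xmu U oU Ux; exists h; apply/eqP => FUh.
have mU : measurable U by exact: open_measurable.
have := Fmu U mU; rewrite FUh (linear0l (@l2dot R)) => /esym/complexI mu0.
by have := xmu U oU Ux; rewrite -[mu U]fineK ?fin_num_measure// mu0 ltxx.
Qed.

(** Obtained by evaluating the operator triplet formula at <(.) delta_k, delta_k>.
    The quadratic coefficients are left existential because fourth differences
    annihilate them. *)
Lemma lam_hat_triplet (lam : R^nat) (W B C : {linear ell2 R -> ell2 R}) F k
    (mu : {finite_measure set R -> \bar R}) :
  is_weighted_shift lam W -> representing_triplet W B C F ->
  marginal F (delta k) mu -> exists b c, forall n,
  lam_hat lam (n + k) = lam_hat lam k * (1 + b * n%:R + c * n%:R ^+ 2 +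
    \int[mu]_(x in @Rplus R) (Qpoly R n).[x]).
Proof.
move=> shiftW tripletW Fmu; have [S [_ WS WnE]] := tripletE tripletW.
exists (complex.Re (l2dot (B (delta k)) (delta k))), (complex.Re (l2dot (C (delta k)) (delta k))) => n.
have [G [_ /(_ _ _ Fmu)[_ GE]] /(_ (delta k)) E] := WnE n.
have := dot_iter_shift n k shiftW; rewrite -(iter_adjoint _ _ _ WS) E.
rewrite !(linearDl (@l2dot R)) !(linearZl_LR (@l2dot R))/= GE.
rewrite -(rmorph_nat (@real_complex R)) -rmorphXn [l2dot (delta k) _]l2dot_basis /= eqxx.
case: (l2dot (B _) _) (l2dot (C _) _) => [x y] [z t] /(congr1 (@complex.Re R))/= <-.
by ring.
Qed.

End diagonal_marginals.

Unset Implicit Arguments.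
Set Strict Implicit.

Theorem proposition6p4 (R : realType) (lam : R^nat)
    (W : {linear ell2 R -> ell2 R})
    (b c : R) (nu : {finite_measure set R -> \bar R})
    (B C : {linear ell2 R -> ell2 R}) (F : set R -> {linear ell2 R -> ell2 R}) :
  (forall n, 0 < lam n) ->
  (exists M : R, forall n, lam n <= M) ->
  is_weighted_shift lam W ->
  cpd_op W ->
  scalar_triplet lam b c nu ->
  representing_triplet W B C F ->
  1 < sup (supp nu) ->
  ~ supp nu 1 ->
  ~ compact_op (F (@Rplus R)).
Proof.
move=> lam0 _ shiftW _ nuP tripletW sup1 nu1 cF.
have [e e0 diff4_ge] := lam_hat_le_diff4 nuP sup1 nu1.
have [L L0 FL] := compact_sub_itv (triplet_F_supp tripletW).
have L10 : 0 < (L + 1) ^+ 2 by rewrite exprn_gt0// addr_gt0.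
have diag_ge k : (e / (L + 1) ^+ 2)%:C%C <=
    l2dot (F (@Rplus R) (ell2_basis R k)) (ell2_basis R k).
  have [mu Fmu] :=
    semispectral_measure (triplet_F_semispectral tripletW) (ell2_basis R k).
  have muL : mu (~` `[- L, L]) = 0%E.
    by apply: measure_setC_supp_sub => //; exact: subset_trans (supp_marginal Fmu) FL.
  have lamk := lam_hat_gt0 k lam0.
  have [b' [c' lamE]] := lam_hat_triplet shiftW tripletW Fmu.
  rewrite Fmu ?lecR; last exact: measurable_Rplus.
  rewrite ler_pdivrMr// mulrC; apply: le_trans (integral_sqr_le muL muL).
  rewrite -(ler_pM2r lamk); apply: le_trans (diff4_ge k) _.
  rewrite -(@diff4_triplet _ _ _ muL (fun n => lam_hat lam (n + k) / lam_hat lam k) 1 b' c').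
    by rewrite /diff4 !mulrDl !mulNr !mulrnAl !divfK ?gt_eqF.
  by move=> n; rewrite lamE mulrAC mulfV ?mul1r// gt_eqF.
have [|k] := compact_op_diag (e := (e / (L + 1) ^+ 2)%:C%C) cF.
  by rewrite ltcR divr_gt0.
have e_ge0 : 0 <= (e / (L + 1) ^+ 2)%:C%C :> R[i] by rewrite lecR divr_ge0// ltW.
have diag_real := ger0_real (le_trans e_ge0 (diag_ge k)).
by move/(le_lt_trans (le_trans (diag_ge k) (real_ler_norm diag_real))); rewrite ltxx.
Qed.
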